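(* Fix the sample size $n=n_0>0$. Suppose $\Theta\ni\theta$ is a metric space. Let the bounded-DP likelihood be $L(\theta;s):=p(s\mid\theta,n=n_0)$, and let the unbounded-DP likelihood be $$L_\epsilon(\theta;s,n_{\mathrm{dp}}):=\sum_{k=1}^\infty p(s\mid\theta,n=k)\,p_\epsilon(n=k\mid n_{\mathrm{dp}}),$$ where $p_\epsilon(n\mid n_{\mathrm{dp}})$ is a proper posterior distribution and $\epsilon$ is the privacy loss budget for the mechanism $p(n_{\mathrm{dp}}\mid n)$. For each $\epsilon$, let $\hat\theta_\epsilon$ be a (potentially) random element of $\Theta$ such that $$L_\epsilon(\hat\theta_\epsilon;s,n_{\mathrm{dp}})\ \ge\ \sup_{\theta\in\Theta}L_\epsilon(\theta;s,n_{\mathrm{dp}})-o_p(1),$$ where the $o_p(1)$ term is with respect to $\epsilon\to\infty$. Suppose that the following conditions hold: (i) (Unique bounded-DP MLE) almost all sample paths $\theta\mapsto L(\theta;s)$ are upper semi-continuous and each has a unique maximum point $\hat\theta(n_0,s)$. (ii) (Uniform convergence on compact sets) for every compact subset $K$ of $\Theta$, $L_\epsilon(\cdot;s,n_{\mathrm{dp}})\overset{d}{\to}L(\cdot;s)$ in $\ell^\infty(K)$ as $\epsilon\to\infty$, where probabilities are over the randomness in both $s$ and $n_{\mathrm{dp}}$. (iii) (Tightness) for every $c>0$ there exists a compact set $K_c\subset\Theta$ such that $$\limsup_{\epsilon\to\infty}\mathbb{P}(\hat\theta_\epsilon\notin K_c)\le c,\qquad \mathbb{P}(\hat\theta(n_0,s)\notin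 K_c)\le c .$$ Then $\hat\theta_\epsilon\overset{d}{\to}\hat\theta(n_0,s)$ as $\epsilon\to\infty$.
   Context: Setting: the true sample size is $n_0$. A sensitive dataset $x$ of size $n$ has distribution $p(x\mid\theta,n)$, a privatized summary $s$ is drawn from $p(s\mid x)$, and $p(s\mid\theta,n=k)=\int p(s\mid x)p(x\mid\theta,n=k)\,dx$ is the marginal density of $s$ when the sample size is $k$. A privatized sample size $n_{\mathrm{dp}}$ is drawn from a mechanism $p_\epsilon(n_{\mathrm{dp}}\mid n)$ indexed by a budget parameter $\epsilon>0$ (no particular privacy definition is required), conditionally independently of $s$ given the data, so the law of $n_{\mathrm{dp}}$ depends on $\epsilon$. With a prior $p(n)$ on $\{1,2,\dots\}$, $p_\epsilon(n=k\mid n_{\mathrm{dp}})\propto p_\epsilon(n_{\mathrm{dp}}\mid n=k)p(n=k)$. $\ell^\infty(K)$ is the space of bounded real functions on $K$ with the supremum norm, and $\overset{d}{\to}$ denotes convergence in distribution (weak convergence). *)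

(* Defs.v *)
From HB Require Import structures.
From mathcomp Require Import all_boot all_order all_algebra.
From mathcomp Require Import all_classical all_reals all_analysis.

Set Implicit Arguments.
Unset Strict Implicit.
Unset Printing Implicit Defensive.

Import Order.TTheory GRing.Theory Num.Theory.
Import numFieldNormedType.Exports.

Local Open Scope classical_set_scope.
Local Open Scope ring_scope.
Local Open Scope ereal_scope.

Definition borel_map d (Omega : measurableType d) (T : topologicalType)
    (X : Omega -> T) : Prop :=
  forall B : set T, <<s [set U : set T | open U] >> B -> measurable (X @^-1` B).

(* Meant for bounded h only, where it is finite and does not change if U is
   allowed to be any measurable majorant whose integral exists. *)
Definition outer_expectation (R : realType) d (Omega : measurableType d)
    (P : probability Omega R) (h : Omega -> R) : \bar R :=
  ereal_inf [set 'E_P[U] | U in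
    [set U : Omega -> R |
      P.-integrable setT (EFin \o U) /\ forall w, (h w <= U w)%R]].

(* Weak convergence as e -> +oo in the sense of Hoffmann-Jorgensen: the limit
   is Borel, the maps Xe e may fail to be measurable. When they are Borel this
   is the usual weak convergence, outer expectations being then expectations.
   Outer expectations are needed because l^oo(K) is not separable in general. *)
Definition weak_cvg (R : realType) d (Omega : measurableType d)
    (P : probability Omega R) (T : topologicalType)
    (Xe : R -> Omega -> T) (X : Omega -> T) : Prop :=
  borel_map X /\
  forall f : T -> R, continuous f -> (exists M, forall t, (`|f t| <= M)%R) ->
    outer_expectation P (f \o Xe e) @[e --> +oo%R] --> 'E_P[f \o X].

(* The subset of bounded functions in the space of all functions on the
   subtype K, with the topology of uniform convergence; seen as a type, it has
   the induced topology, which is that of the supremum norm. *)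
Definition linfty (R : realType) (Theta : choiceType) (K : set Theta) :
    set {uniform (set_type K) -> R} :=
  [set g | exists M, forall t : set_type K, (`|(g : _ -> R) t| <= M)%R].
Arguments linfty R {Theta} K _.

Lemma linfty_nbhsP (R : realType) (Theta : choiceType) (K : set Theta)
    (g : linfty R K) (A : set (linfty R K)) :
  nbhs g A <-> exists2 e : R, (0 < e)%R &
    forall h : linfty R K,
      (forall t, (`|(set_val g : _ -> R) t - (set_val h : _ -> R) t| < e)%R) ->
      A h.
Proof.
split.
- rewrite nbhsE => -[B [[W oW <-] Bg] BA].
  have : nbhs (set_val g) W by move: (@open_nbhs_nbhs _ (set_val g) W); apply.
  move=> /uniform_nbhs[E [[e /= e0 eE] EW]].
  exists e => // h H; apply: BA; apply: EW => t _. by apply: eE; exact: H.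
- move=> [e e0 H].
  have N : nbhs (set_val g : {uniform (set_type K) -> R}) [set h | forall t, (`|(set_val g : _ -> R) t - (h : _ -> R) t| < e)%R].
    apply/uniform_nbhs; exists [set xy | (`|xy.1 - xy.2| < e)%R]; split.
      by exists e => //= -[].
    by move=> h /= Hh t; exact: Hh.
  have Hn := @initial_continuous _ _ (@set_val _ (linfty R K)) g _ N.
  by apply: (@filterS _ (nbhs g) _ _ _ _ Hn) => h Hh; exact: H.
Qed.

(* Sample paths are extended real valued; they define random elements of
   l^oo(K) up to null sets as soon as almost all of them are finite and bounded
   on K. *)
Definition linfty_version (R : realType) d (Omega : measurableType d)
    (P : probability Omega R) (Theta : choiceType) (K : set Theta)
    (M : Omega -> Theta -> \bar R) (X : Omega -> linfty R K) : Prop :=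
  {ae P, forall w, forall t : set_type K,
    ((set_val (X w) : _ -> R) t)%:E = M w (set_val t)}.

Definition weak_cvg_linfty (R : realType) d (Omega : measurableType d)
    (P : probability Omega R) (Theta : choiceType) (K : set Theta)
    (Me : R -> Omega -> Theta -> \bar R) (M : Omega -> Theta -> \bar R) : Prop :=
  exists (Xe : R -> Omega -> linfty R K) (X : Omega -> linfty R K),
    [/\ forall e : R, (0 < e)%R -> linfty_version P (Me e) (Xe e),
        linfty_version P M X
      & weak_cvg P Xe X].

Definition little_op1 (R : realType) d (Omega : measurableType d)
    (P : probability Omega R) (r : R -> Omega -> R) : Prop :=
  forall delta : R, (0 < delta)%R ->
    mu_ext P [set w | (delta < `|r e w|)%R] @[e --> +oo%R] --> 0.

Definition upper_semicontinuous (R : realType) (T : topologicalType)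
    (f : T -> \bar R) : Prop :=
  lower_semicontinuous (fun t => - f t).

Definition unique_maximum (R : realType) (T : Type) (f : T -> \bar R) (t : T) :
    Prop :=
  forall u, u <> t -> f u < f t.

Definition is_density (R : realType) d (T : measurableType d)
    (mu : {measure set T -> \bar R}) (f : T -> R) : Prop :=
  [/\ measurable_fun setT f, forall x, (0 <= f x)%R
    & \int[mu]_x (f x)%:E = 1].

Section likelihoods.
Context (R : realType) (Theta : Type).
Context dX (X : nat -> measurableType dX).
Context (nu : forall k, {sigma_finite_measure set (X k) -> \bar R}).
Context dS (S : measurableType dS) dN (N : measurableType dN).
Variables (px : forall k, Theta -> X k -> R) (ps : forall k, X k -> S -> R).
Variables (pdp : R -> nat -> N -> R) (prior : nat -> R).

(* p(s | theta, n = k) *)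
Definition marginal (k : nat) (th : Theta) (s : S) : \bar R :=
  \int[nu k]_x (ps x s * px th x)%:E.

(* p_e(n = k | ndp). If the normalizing series is infinite or zero, this is 0
   for all k, so that it is a probability on {1, 2, ...} exactly when the
   posterior is proper. *)
Definition posterior (e : R) (m : N) (k : nat) : R :=
  (pdp e k m * prior k / fine (\sum_(1 <= j <oo) (pdp e j m * prior j)%:E))%R.

Definition proper_posterior (e : R) (m : N) : Prop :=
  \sum_(1 <= k <oo) (posterior e m k)%:E = 1.

Definition unbounded_lik (e : R) (th : Theta) (s : S) (m : N) : \bar R :=
  \sum_(1 <= k <oo) (marginal k th s * (posterior e m k)%:E).

End likelihoods.

(* Main.v *)
(** The argmax continuous mapping theorem of van der Vaart and Wellner.  For a
closed [F] and a compact [K], a near maximizer lying in [F `&` K] forces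
[sup_(F `&` K) - sup_K] of the random likelihood to be almost nonnegative.  This
functional is continuous on l^oo(K), so in the limit the probability of this
event is at most that of [sup_(F `&` K) L >= sup_K L], which by upper
semicontinuity and uniqueness puts the MLE in [F] or outside [K].  Tightness
removes [K], and a layer-cake argument for outer expectations (one half of the
portmanteau theorem) passes from closed sets to weak convergence. *)

Require Import Defs.
From HB Require Import structures.
From mathcomp Require Import all_boot all_order all_algebra.
From mathcomp Require Import all_classical all_reals all_analysis.
From mathcomp Require Import measurable_realfun ring lra.

Set Implicit Arguments.
Unset Strict Implicit.
Unset Printing Implicit Defensive.

Import Order.TTheory GRing.Theory Num.Theory.
Import numFieldNormedType.Exports.

Local Open Scope classical_set_scope.
Local Open Scope ring_scope.
Local Open Scope ereal_scope.

(** * Outer probability and outer expectation *)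

Section outer_probability.
Context (R : realType) d (Omega : measurableType d) (P : probability Omega R).

Lemma mu_extU2 (A B : set Omega) :
  mu_ext P (A `|` B) <= mu_ext P A + mu_ext P B.
Proof. exact: outer_measureU2. Qed.

(** Adding a measurable null set that contains the exceptional points to [B] costs nothing. Events
    about the near maximizers may fail to be measurable, so almost sure inclusions are compared in
    this form. *)
Lemma mu_ext_ae_le (A B : set Omega) :
  {ae P, forall w, A w -> B w} -> mu_ext P A <= mu_ext P B.
Proof.
move=> [Z [mZ PZ ABZ]].
apply: (@le_trans _ _ (mu_ext P (B `|` Z))).
  apply: le_mu_ext => w Aw; have [Bw|nBw] := pselect (B w); first by left.
  by right; apply: ABZ => /(_ Aw).
apply: (le_trans (mu_extU2 _ _)).
suff -> : mu_ext P Z = 0 by rewrite adde0.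
by rewrite -PZ; exact: measurable_mu_extE.
Qed.

Lemma mu_ext_le1 (A : set Omega) : mu_ext P A <= 1.
Proof.
by rewrite -(@probability_setT _ _ _ P) -measurable_mu_extE//; exact: le_mu_ext.
Qed.

Lemma mu_ext_fin_num (A : set Omega) : mu_ext P A \is a fin_num.
Proof.
rewrite ge0_fin_numE ?mu_ext_ge0//.
by apply: (le_lt_trans (mu_ext_le1 A)); rewrite ltry.
Qed.

(** The set [B] is the union of a countable measurable cover whose total mass is within [eta] of the
    infimum. *)
Lemma mu_ext_measurable_superset (A : set Omega) (eta : R) : (0 < eta)%R ->
  exists B, [/\ measurable B, A `<=` B & P B <= mu_ext P A + eta%:E].
Proof.
move=> eta0.
have [_ [F [mF AF] <-] lt] := lb_ereal_inf_adherent eta0 (mu_ext_fin_num A).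
have mUF : measurable (\bigcup_k F k) by exact: bigcup_measurable.
exists (\bigcup_k F k); split => //.
by apply: le_trans (ltW lt); exact: measure_sigma_subadditive.
Qed.

(** Markov's inequality at level 1, applied to every integrable majorant [U] of [h]: such a [U] is
    nonnegative and at least 1 on [A]. *)
Lemma mu_ext_le_outer_expectation (A : set Omega) (h : Omega -> R) :
  (forall w, (0 <= h w)%R) -> (forall w, A w -> (1 <= h w)%R) ->
  mu_ext P A <= outer_expectation P h.
Proof.
move=> h0 h1; apply: le_ereal_inf_tmp => _ [U [iU hU] <-].
have mU : measurable_fun setT U by apply/measurable_EFinP; case/integrableP: iU.
have mB : measurable [set w | (1 <= U w)%R].
  suff -> : [set w | (1 <= U w)%R] = U @^-1` `[1%R, +oo[.
    by rewrite -[X in measurable X]setTI; exact: mU.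
  by apply/seteqP; split => w; rewrite /= in_itv/= andbT.
apply: (@le_trans _ _ (P [set w | (1 <= U w)%R])).
  rewrite -measurable_mu_extE//; apply: le_mu_ext => w /h1 /le_trans; exact.
rewrite unlock.
apply: (@le_trans _ _ (\int[P]_w (\1_[set w | (1 <= U w)%R] w)%:E)).
  by rewrite integral_indic// setIT.
apply: ge0_le_integral => //.
- by apply/measurable_EFinP; exact: measurable_indic.
- exact/measurable_EFinP.
move=> w _; rewrite lee_fin indicE.
by case: (boolP (w \in _)) => [/set_mem//|_]; exact: le_trans (h0 w) (hU w).
Qed.

Lemma outer_expectation_le (h U : Omega -> R) :
  P.-integrable setT (EFin \o U) -> (forall w, (h w <= U w)%R) ->
  outer_expectation P h <= 'E_P[U].
Proof. by move=> iU hU; apply: ereal_inf_lbound; exists U. Qed.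

(** The left side is the inner expectation of [h]: if [V] majorizes [- h] and [U] majorizes [h],
    then [- V <= h <= U]. This turns an upper bound for [- f] into a lower bound for [f]. *)
Lemma oppe_outer_expectation_le (h : Omega -> R) :
  - outer_expectation P (fun w => - h w)%R <= outer_expectation P h.
Proof.
rewrite leeNl; apply: le_ereal_inf_tmp => _ [V [iV hV] <-].
rewrite leeNl; apply: le_ereal_inf_tmp => _ [U [iU hU] <-].
rewrite unlock -integralN; last exact: integrable_add_def.
apply: le_integral => //; first exact: integrableN.
move=> w _; rewrite lee_fin; have := hU w; have := hV w; lra.
Qed.

Lemma mu_ext_near_le (S : topologicalType) (F : set_system S) {FF : Filter F}
    (A : S -> set Omega) (c eta : R) : (0 < eta)%R ->
  mu_ext P (A e) @[e --> F] --> c%:E ->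
  \forall e \near F, mu_ext P (A e) <= (c + eta)%:E.
Proof.
move=> eta0 /fine_cvgP[fA cA].
have := cvgr_le _ cA (c + eta)%R.
rewrite ltrDl => /(_ FF eta0); apply: filterS2 fA => e fA.
by rewrite -[in X in _ -> X](fineK fA) lee_fin.
Qed.

End outer_probability.

(** * Counting integer levels below a real number *)

(** The sum counts the integers from 1 to [n] that are at most [y], so it is the smaller of [n] and
    the integer part of [y]. *)
Lemma sum_steps_le (R : realFieldType) (y : R) n : (0 <= y)%R ->
  (\sum_(i < n) (i.+1%:R <= y)%R%:R <= y)%R.
Proof.
move=> y0; elim: n => [|n IH]; first by rewrite big_ord0.
rewrite big_ord_recr/=; have [ny|_] := leP (n.+1%:R : R) y; last first.
  by rewrite addr0.
apply: le_trans ny; rewrite -natr1 lerD2r.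
apply: (@le_trans _ _ (\sum_(i < n) 1)%R).
  by apply: ler_sum => i _; case: (leP _ y) => _; rewrite ?ler01.
by rewrite sumr_const card_ord.
Qed.

(** Below [n.+1] no level is missed: for nonnegative [y] the count is the full integer part. *)
Lemma lt_sum_steps (R : realFieldType) (y : R) n : (y < n.+1%:R)%R ->
  (y < 1 + \sum_(i < n) (i.+1%:R <= y)%R%:R)%R.
Proof.
elim: n => [|n IH] yn; first by rewrite big_ord0 addr0.
have [ny|/IH/lt_le_trans] := leP (n.+1%:R : R) y; last first.
  by apply; rewrite lerD2l big_ord_recr/= lerDl.
rewrite (eq_bigr (fun=> 1%R)) => [|i _].
  by rewrite sumr_const card_ord nat1r.
suff -> : (i.+1%:R <= y)%R by [].
by apply: le_trans ny; rewrite ler_nat.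
Qed.

(** * From closed sets to weak convergence *)

Section portmanteau.
Context (R : realType) d (Omega : measurableType d) (P : probability Omega R).

Lemma expectation_layers (c h : R) (B : nat -> set Omega) n :
  (forall i, measurable (B i)) ->
  P.-integrable setT
    (EFin \o (fun w => c + h * \sum_(i < n) (\1_(B i) w : R)))%R /\
  'E_P[fun w => c + h * \sum_(i < n) (\1_(B i) w : R)]%R =
    (c + h * \sum_(i < n) fine (P (B i)))%:E.
Proof.
move=> mB; elim: n => [|n [IHi IHe]].
  rewrite !big_ord0.
  have -> : (fun w => c + h * \sum_(i < 0) (\1_(B i) w : R))%R = cst c.
    by apply/funext => w; rewrite big_ord0 mulr0 addr0.
  split; first exact: finite_measure_integrable_cst.
  by rewrite expectation_cst mulr0 addr0.
have iB : P.-integrable setT (fun w => h%:E * (\1_(B n) w)%:E).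
  exact/integrableZl/integrable_indic.
have E : EFin \o (fun w => c + h * \sum_(i < n.+1) (\1_(B i) w : R))%R =
    (EFin \o (fun w => c + h * \sum_(i < n) (\1_(B i) w : R))%R) \+
    (fun w => h%:E * (\1_(B n) w)%:E).
  by apply/funext => w /=; rewrite big_ord_recr/= mulrDr addrA EFinD EFinM.
split; first by rewrite E; exact: integrableD.
move: IHe; rewrite unlock => IHe.
rewrite -[LHS]/(integral P setT
  (EFin \o (fun w => c + h * \sum_(i < n.+1) (\1_(B i) w : R))%R)) E.
rewrite integralD// IHe.
rewrite integralZl//; last exact: integrable_indic.
rewrite integral_indic// setIT big_ord_recr/= mulrDr addrA [RHS]EFinD.
by rewrite EFinM fineK// fin_num_measure.
Qed.

Context (T : topologicalType).

Lemma borel_map_open (X : Omega -> T) (U : set T) :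
  borel_map X -> open U -> measurable (X @^-1` U).
Proof. by move=> bX oU; apply: bX; exact: sub_gen_smallest. Qed.

Lemma borel_map_closed (X : Omega -> T) (F : set T) :
  borel_map X -> closed F -> measurable (X @^-1` F).
Proof.
move=> bX cF; rewrite -(setCK F) preimage_setC; apply: measurableC.
exact: (borel_map_open bX (closed_openC cF)).
Qed.

Lemma borel_map_continuous (X : Omega -> T) (f : T -> R) :
  borel_map X -> continuous f -> measurable_fun setT (f \o X).
Proof.
move=> bX cf; apply: (measurability _ (RGenOInfty.measurableE R)).
move=> _ [_ [a ->] <-]; rewrite setTI comp_preimage.
apply: (borel_map_open bX).
by move/continuousP: cf; apply; exact: interval_open.
Qed.

Lemma integrable_borel_map (X : Omega -> T) (f : T -> R) :
  borel_map X -> continuous f -> (exists M, forall t, (`|f t| <= M)%R) ->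
  P.-integrable setT (EFin \o (f \o X)).
Proof.
move=> bX cf [M fM]; apply: measurable_bounded_integrable => //.
- by rewrite (le_lt_trans (probability_le1 _ _)) ?ltry.
- exact: borel_map_continuous.
- by exists M; split; [exact: num_real|move=> N MN w _ /=; rewrite (le_trans (fM _))// ltW].
Qed.

(* With [h := 2M / n], the step function
   [-M + h * #{i < n | (i+1)h <= f + M}] approximates [f] from below within
   [h]. *)
Lemma near_outer_expectation_le (Xe : R -> Omega -> T) (X : Omega -> T)
    (f : T -> R) :
  borel_map X ->
  (forall F, closed F -> forall eta : R, (0 < eta)%R ->
    \forall e \near +oo%R,
      mu_ext P (Xe e @^-1` F) <= P (X @^-1` F) + eta%:E) ->
  continuous f -> (exists M, forall t, (`|f t| <= M)%R) ->
  forall eta : R, (0 < eta)%R ->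
  \forall e \near +oo%R,
    outer_expectation P (f \o Xe e) <= 'E_P[f \o X] + eta%:E.
Proof.
move=> bX closedX cf [M0 fM0] eta eta0.
have [M M_gt0 fM] : exists2 M : R, (0 < M)%R & forall t, (`|f t| <= M)%R.
  exists (Num.max M0 1)%R; first by rewrite lt_max ltr01 orbT.
  by move=> t; rewrite le_max fM0.
(* Since [n] exceeds [4 * M / eta], the mesh [h] is at most [eta / 2]; this is the first half of the
   allowed error. *)
pose n := (Num.trunc (4 * M / eta)).+1.
have n0 : (0 < n%:R :> R)%R by rewrite ltr0n.
pose h : R := (2 * M / n%:R)%R.
have h0 : (0 < h)%R by rewrite divr_gt0// mulr_gt0.
have hn : (h * n%:R = 2 * M)%R by rewrite divfK// gt_eqF.
have h_le : (h <= eta / 2)%R.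
  have : (4 * M / eta < n%:R)%R by exact: truncnS_gt.
  by rewrite ltr_pdivrMr// /h ler_pdivrMr// => ?; lra.
pose F i : set T := [set t | (i.+1%:R <= (f t + M) / h)%R].
have cF i : closed (F i).
  have -> : F i = f @^-1` [set y | (i.+1%:R * h - M <= y)%R].
    by apply/seteqP; split => t; rewrite /F/= ler_pdivlMr// => ?; lra.
  by apply: preimage_closed; [move=> ? _; exact: cf|exact: closed_ge].
have indicF t i : \1_(F i) t = (i.+1%:R <= (f t + M) / h)%R%:R :> R.
  by rewrite indicE; congr ((nat_of_bool _)%:R)%R; apply/idP/idP => [/set_mem//|?]; exact/mem_set.
have steps_le t : (- M + h * \sum_(i < n) \1_(F i) t <= f t)%R.
  rewrite addrC -lerBrDr opprK mulrC -ler_pdivlMr//.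
  under eq_bigr do rewrite indicF.
  apply: sum_steps_le; apply: divr_ge0; last exact: ltW.
  by have := fM t; rewrite ler_norml => /andP[]; lra.
have le_steps t : (f t <= - M + h + h * \sum_(i < n) \1_(F i) t)%R.
  under eq_bigr do rewrite indicF.
  have /lt_sum_steps : ((f t + M) / h < n.+1%:R)%R.
    rewrite ltr_pdivrMr// mulrC -natr1 mulrDr mulr1 hn.
    by have := fM t; rewrite ler_norml => /andP[]; lra.
  by rewrite ltr_pdivrMr// mulrDl mul1r [(_ * h)%R]mulrC => ?; lra.
(* Each of the [n] layers has weight [h] and loses [2 * eta']: once in passing to the limit, once in
   replacing a preimage by a measurable superset. As [h * n = 2 * M], the total loss is
   [eta / 2]. *)
pose eta' : R := (eta / (8 * M))%R.
have eta'0 : (0 < eta')%R by rewrite divr_gt0// mulr_gt0.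
have : \forall e \near +oo%R, forall i : 'I_n,
    mu_ext P (Xe e @^-1` F i) <= P (X @^-1` F i) + eta'%:E.
  by apply: filter_forall => i; exact: closedX.
apply: filterS => e XeF.
(* The preimages under [Xe e] may be nonmeasurable; the sets [B i] make the upper step function an
   integrable majorant. *)
have /choice[B BP] i : exists B, [/\ measurable B, Xe e @^-1` F i `<=` B &
    P B <= mu_ext P (Xe e @^-1` F i) + eta'%:E].
  exact: mu_ext_measurable_superset.
have mB i : measurable (B i) by case: (BP i).
have mXF i : measurable (X @^-1` F i) by exact: borel_map_closed.
have PB (i : 'I_n) : (fine (P (B i)) <= fine (P (X @^-1` F i)) + 2 * eta')%R.
  rewrite -lee_fin EFinD !fineK ?fin_num_measure//.
  have [_ _ /le_trans] := BP i; apply.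
  rewrite (_ : 2 * eta' = eta' + eta')%R ?EFinD ?addeA; last by ring.
  by rewrite leeD2r.
have [iU EU] := expectation_layers (- M + h)%R h n mB.
have [iV EV] := expectation_layers (- M)%R h n mXF.
have : outer_expectation P (f \o Xe e) <=
    (- M + h + h * \sum_(i < n) fine (P (B i)))%:E.
  rewrite -EU; apply: outer_expectation_le => // w /=.
  apply: (le_trans (le_steps _)); rewrite lerD2l ler_pM2l//.
  apply: ler_sum => i _; rewrite !indicE ler_nat.
  case: (boolP (Xe e w \in F i)) => [/set_mem FXe|//].
  have [_ sB _] := BP i.
  by have /mem_set -> := sB _ FXe.
move/le_trans; apply.
have : (- M + h * \sum_(i < n) fine (P (X @^-1` F i)))%:E <= 'E_P[f \o X].
  rewrite -EV unlock; apply: le_integral => //.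
    by apply: (integrable_borel_map bX cf); exists M.
  by move=> w _; rewrite lee_fin; exact: steps_le.
move=> /(leeD2r eta%:E); apply: le_trans; rewrite -EFinD lee_fin.
have : (\sum_(i < n) fine (P (B i)) <=
    \sum_(i < n) fine (P (X @^-1` F i)) + n%:R * (2 * eta'))%R.
  rewrite mulr_natl -[X in (_ *+ X)%R]card_ord -sumr_const -big_split/=.
  exact: ler_sum.
have heta' : (h * (n%:R * (2 * eta')) = eta / 2)%R.
  by rewrite mulrA hn /eta'; field; rewrite gt_eqF.
by move=> /(ler_wpM2l (ltW h0)); rewrite mulrDr heta' => ?; lra.
Qed.

(** The one-sided bound applied to [f] gives the upper estimate. Applied to [- f], it bounds the
    inner expectation of [f] from below, hence also the outer one. *)
Lemma weak_cvg_closed (Xe : R -> Omega -> T) (X : Omega -> T) :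
  borel_map X ->
  (forall F, closed F -> forall eta : R, (0 < eta)%R ->
    \forall e \near +oo%R,
      mu_ext P (Xe e @^-1` F) <= P (X @^-1` F) + eta%:E) ->
  weak_cvg P Xe X.
Proof.
move=> bX closedX; split => // f cf bf.
have iX := integrable_borel_map bX cf bf.
have bNf : exists M, forall t, (`|- f t| <= M)%R.
  by have [M fM] := bf; exists M => t; rewrite normrN.
have cNf : continuous (fun t => - f t)%R by move=> t; apply: cvgN; exact: cf.
have fE : 'E_P[f \o X] \is a fin_num.
  by rewrite unlock; exact: integrable_fin_num.
have NE : 'E_P[(fun t => - f t)%R \o X] = - 'E_P[f \o X].
  by rewrite unlock -integralN//; exact: integrable_add_def.
rewrite -(fineK fE); apply/fine_cvgP.
have bounds eta : (0 < eta)%R -> \forall e \near +oo%R,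
    'E_P[f \o X] - eta%:E <= outer_expectation P (f \o Xe e) <=
    'E_P[f \o X] + eta%:E.
  move=> eta0.
  have := near_outer_expectation_le bX closedX cf bf eta0.
  apply: filterS2 (near_outer_expectation_le bX closedX cNf bNf eta0).
  move=> e; rewrite NE => loe ->; rewrite andbT.
  apply: le_trans (oppe_outer_expectation_le _ _).
  by rewrite leeNr fin_num_oppeB.
split.
  apply: filterS (bounds _ ltr01) => e /andP[le1 le2].
  rewrite fin_numElt (lt_le_trans _ le1) ?(le_lt_trans le2)//.
  - by rewrite -(fineK fE) -EFinD ltry.
  - by rewrite -(fineK fE) -EFinB ltNyr.
apply/cvgrPdist_le => eta eta0; apply: filterS (bounds _ eta0) => e /=.
rewrite -(fineK fE) -EFinB -EFinD.
case: (outer_expectation _ _) => [r||]; rewrite ?lee_fin ?leeNy_eq ?leye_eq ?andbF//=.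
by rewrite ler_distlC.
Qed.

End portmanteau.

(** * Consequences of weak convergence for superlevel sets of a continuous functional *)

Section weak_limit.
Context (R : realType) d (Omega : measurableType d) (P : probability Omega R).
Context (T : topologicalType) (Xe : R -> Omega -> T) (X : Omega -> T).
Context (XeX : weak_cvg P Xe X).

(** The gap between [a] and [b] leaves room for a continuous ramp [f] of [phi], rising from 0 at [a]
    to 1 at [b]. It lies above the indicator of the superlevel set at [b] and below that at [a]. *)
Lemma weak_cvg_near_le (phi : T -> R) (a b eta : R) :
  continuous phi -> (a < b)%R -> (0 < eta)%R ->
  \forall e \near +oo%R,
    mu_ext P [set w | (b <= phi (Xe e w))%R] <=
    P [set w | (a <= phi (X w))%R] + eta%:E.
Proof.
move=> cphi ab eta0; have [bX cvgX] := XeX.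
have ba0 : (0 < b - a)%R by rewrite subr_gt0.
pose f t : R := Num.max 0%R (Num.min 1%R ((phi t - a) / (b - a)))%R.
have f0 t : (0 <= f t)%R by rewrite le_max lexx.
have f1 t : (f t <= 1)%R by rewrite ge_max ler01 ge_min lexx.
have cf : continuous f.
  move=> t; pose g t := ((phi t - a) / (b - a))%R.
  apply: (@continuous_max _ _ (cst 0%R) (cst 1%R \min g)); first exact: cvg_cst.
  apply: (@continuous_min _ _ (cst 1%R) g); first exact: cvg_cst.
  by apply: cvgM; [apply: cvgB; [exact: cphi|exact: cvg_cst]|exact: cvg_cst].
have bf : exists M, forall t, (`|f t| <= M)%R.
  by exists 1%R => t; rewrite ger0_norm.
have mA : measurable [set w | (a <= phi (X w))%R].
  apply: (borel_map_closed bX (F := phi @^-1` [set y | (a <= y)%R])).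
  by apply: preimage_closed; [move=> ? _; exact: cphi|exact: closed_ge].
have fE : 'E_P[f \o X] \is a fin_num.
  rewrite unlock; apply: integrable_fin_num => //.
  exact: (integrable_borel_map P bX cf bf).
have := cvgX f cf bf; rewrite -(fineK fE) => /fine_cvgP[fin_e cvg_e].
have := cvgr_le _ cvg_e (fine 'E_P[f \o X] + eta)%R.
rewrite ltrDl => /(_ _ eta0); apply: filterS2 fin_e => e fin_e /=.
rewrite -lee_fin (fineK fin_e) EFinD (fineK fE) => le_e.
apply: (@le_trans _ _ (outer_expectation P (f \o Xe e))).
  apply: mu_ext_le_outer_expectation => w /=; first exact: f0.
  move=> bphi; rewrite le_max le_min lexx/= ler_pdivlMr// mul1r lerD2r.
  by rewrite bphi orbT.
apply: (le_trans le_e); rewrite leeD2r//.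
have -> : P [set w | (a <= phi (X w))%R] =
    \int[P]_w (\1_[set w | (a <= phi (X w))%R] w)%:E.
  by rewrite integral_indic// setIT.
rewrite unlock; apply: ge0_le_integral => //.
- by move=> w _; rewrite lee_fin; exact: f0.
- by apply/measurable_EFinP; exact: borel_map_continuous.
- by apply/measurable_EFinP; exact: measurable_indic.
move=> w _; rewrite lee_fin indicE.
case: (boolP (w \in _)) => [_|/negP aphi]; first exact: f1.
rewrite ge_max lexx/= ge_min; apply/orP; right.
rewrite pmulr_lle0 ?invr_gt0// subr_le0 leNgt.
by apply/negP => /ltW aphiw; apply: aphi; exact/mem_set.
Qed.

(** The superlevel sets of [phi \o X] at [- n.+1%:R^-1] decrease to the one at 0, so continuity from
    above bounds their probability for some [n]. The slack [delta] will absorb the error of a near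
    maximizer. *)
Lemma weak_cvg_superlevel (phi : T -> R) (eta : R) :
  continuous phi -> (0 < eta)%R ->
  exists2 delta : R, (0 < delta)%R & \forall e \near +oo%R,
    mu_ext P [set w | (- delta <= phi (Xe e w))%R] <=
    P [set w | (0 <= phi (X w))%R] + eta%:E.
Proof.
move=> cphi eta0; have [bX _] := XeX.
pose A n := [set w | (- n.+1%:R^-1 <= phi (X w))%R].
have mge (a : R) : measurable [set w | (a <= phi (X w))%R].
  apply: (borel_map_closed bX (F := phi @^-1` [set y | (a <= y)%R])).
  by apply: preimage_closed; [move=> ? _; exact: cphi|exact: closed_ge].
have capA : \bigcap_n A n = [set w | (0 <= phi (X w))%R].
  apply/seteqP; split => w /= => [Aw|phi0 n _]; last first.
    by rewrite /A/= (le_trans _ phi0)// oppr_le0 invr_ge0.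
  rewrite leNgt; apply/negP => phi0.
  have phi'0 : (0 < - phi (X w))%R by rewrite oppr_gt0.
  pose n := Num.trunc (- phi (X w))^-1%R.
  have : ((- phi (X w))^-1 < n.+1%:R)%R by exact: truncnS_gt.
  rewrite -ltf_pV2 ?posrE ?invr_gt0// invrK => lt_n.
  by have := Aw n I; rewrite /A/= leNgt ltrNr lt_n.
have : P (A n) @[n --> \oo] --> P (\bigcap_n A n).
  apply: nonincreasing_cvg_mu => //.
  - by rewrite (le_lt_trans (probability_le1 _ _)) ?ltry//; exact: mge.
  - by move=> i; exact: mge.
  - by rewrite capA; exact: mge.
  move=> m n mn; apply/subsetPset => w; rewrite /A/=; apply: le_trans.
  by rewrite lerN2 lef_pV2 ?posrE// ler_nat.
rewrite capA.
have fin0 : P [set w | (0 <= phi (X w))%R] \is a fin_num.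
  by apply: fin_num_measure; exact: mge.
rewrite -(fineK fin0) => /fine_cvgP[finA cvgA].
have eta20 : (0 < eta / 2)%R by rewrite divr_gt0.
have := cvgr_le _ cvgA (fine (P [set w | (0 <= phi (X w))%R]) + eta / 2)%R.
rewrite ltrDl => /(_ _ eta20) nearA.
have [n [finAn leAn]] := filter_ex (filterI finA nearA).
(* Halving puts [- delta] strictly above [- n.+1%:R^-1], as the ramp requires. *)
exists (n.+1%:R^-1 / 2)%R; first by rewrite divr_gt0 ?invr_gt0.
have ltn : (- n.+1%:R^-1 < - (n.+1%:R^-1 / 2) :> R)%R.
  have : (0 < n.+1%:R^-1 :> R)%R by rewrite invr_gt0.
  by move: (n.+1%:R^-1)%R => z z0; lra.
apply: filterS (weak_cvg_near_le cphi ltn eta20) => e /le_trans; apply.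
rewrite -[P _](fineK finAn) -EFinD lee_fin; move: leAn => /=; lra.
Qed.

End weak_limit.

(** * Suprema as functionals on l^oo(K) *)

Section sup_linfty.
Context (R : realType) (Theta : choiceType) (K : set Theta).
Implicit Types (g h : linfty R K) (A : set (set_type K)).

(** The real [sup] takes a default value on the empty set, so upper bounds ask for [A !=set0]. *)
Definition sup_on A g : R := sup [set (set_val g : _ -> R) t | t in A].

Lemma has_ubound_linfty A g : has_ubound [set (set_val g : _ -> R) t | t in A].
Proof.
have [M gM] := set_valP g; exists M => _ [t _ <-].
by apply: le_trans (gM t); exact: ler_norm.
Qed.

Lemma le_sup_on A g t : A t -> ((set_val g : _ -> R) t <= sup_on A g)%R.
Proof. by move=> At; apply: (ub_le_sup (has_ubound_linfty A g)); exists t. Qed.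

Lemma sup_on_le A g (a : R) : A !=set0 ->
  (forall t, A t -> ((set_val g : _ -> R) t <= a)%R) -> (sup_on A g <= a)%R.
Proof.
move=> [t0 At0] ga; apply: ge_sup; first by exists ((set_val g : _ -> R) t0), t0.
by move=> _ [t At <-]; exact: ga.
Qed.

(** A supremum is 1-Lipschitz for the supremum norm, so the same [eps] serves on both sides. *)
Lemma continuous_sup_on A : A !=set0 -> continuous (sup_on A).
Proof.
move=> A0 g; apply/(@cvgrPdist_le _ _ _ _ (nbhs_filter g)) => eps eps0; apply/linfty_nbhsP.
exists eps => // h gh /=; rewrite ler_distl; apply/andP; split.
  rewrite lerBlDr; apply: sup_on_le => // t At.
  have := gh t; have := le_sup_on g At; rewrite ltr_norml; lra.
apply: sup_on_le => // t At.
have := gh t; have := le_sup_on h At; rewrite ltr_norml; lra.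
Qed.

End sup_linfty.

(** A pointwise strict bound need not survive a supremum; this gap does. Near each point of [K]
    upper semicontinuity makes every [q] close enough to [m] from below a strict bound, and
    compactness yields a common [q]. *)
Lemma usc_compact_lt (R : realType) (T : topologicalType) (f : T -> \bar R)
    (K : set T) (m : R) :
  upper_semicontinuous f -> compact K -> (forall t, K t -> f t < m%:E) ->
  exists2 q : R, (q < m)%R & forall t, K t -> f t < q%:E.
Proof.
move=> uf /compact_near_coveringP cK fm.
have : \forall q \near m^'-, K `<=` (fun t => f t < q%:E).
  apply: cK => t Kt.
  have [q [fq qm]] : exists q : R, f t < q%:E /\ (q < m)%R.
    have := fm t Kt; case: (f t) => [r||]//.
      rewrite lte_fin => rm; exists ((r + m) / 2)%R.
      by rewrite lte_fin; split; lra.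
    by move=> _; exists (m - 1)%R; rewrite ltNyr; split => //; lra.
  have [V tV fV] := uf t (- q)%R ltac:(by rewrite EFinN lteN2).
  exists (V, [set p | (q < p)%R]) => /=.
    by split=> //; exact: nbhs_left_gt.
  move=> [u p] [/= /fV Vu qp].
  by move: Vu; rewrite EFinN lteN2 => /lt_trans; apply; rewrite lte_fin.
move=> /(filterI (nbhs_left_lt m))/filter_ex[q [qm fq]].
by exists q.
Qed.

Lemma limf_esup_near_le (S : choiceType) (T : filteredType S) (R : realType)
    (f : T -> \bar R) (F : set_system T) {FF : Filter F} (c eta : R) :
  (0 < eta)%R -> limf_esup f F <= c%:E ->
  \forall t \near F, f t <= (c + eta)%:E.
Proof.
move=> eta0 fc.
have /ereal_inf_lt[_ [V FV <-] supV] : limf_esup f F < (c + eta)%:E.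
  by rewrite (le_lt_trans fc)// lte_fin ltrDl.
apply: filterS FV => t Vt; apply: le_trans (ltW supV).
by apply: ereal_sup_ubound; exists t.
Qed.

(** * The argmax theorem for extended real valued processes *)

Section argmax.
Context (R : realType) d (Omega : measurableType d) (P : probability Omega R).
Context (Theta : topologicalType) (hTheta : hausdorff_space Theta).
Context (Me : R -> Omega -> Theta -> \bar R) (M : Omega -> Theta -> \bar R).
Context (the : R -> Omega -> Theta) (th : Omega -> Theta) (r : R -> Omega -> R).
Context (r_op1 : little_op1 P r).
Context (near_max : forall e, (0 < e)%R -> {ae P, forall w,
  ereal_sup [set Me e w t | t in [set: Theta]] - (r e w)%:E <=
  Me e w (the e w)}).
Context (borel_th : borel_map th).
Context (argmax_th : {ae P, forall w,
  upper_semicontinuous (M w) /\ unique_maximum (M w) (th w)}).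

Lemma set_val_surj (K : set Theta) t : K t ->
  exists u : set_type K, set_val u = t.
Proof. by move=> Kt; exists (SigSub (mem_set Kt)). Qed.

(** The functional [phi] sees the processes on [K] only, so a limit maximizer outside [K] cannot be
    ruled out here; its probability stays in the bound. *)
Lemma argmax_near_le (F K : set Theta) (eta : R) :
  closed F -> compact K -> weak_cvg_linfty P K Me M -> (0 < eta)%R ->
  \forall e \near +oo%R, mu_ext P [set w | (F `&` K) (the e w)] <=
    P (th @^-1` F) + P [set w | ~ K (th w)] + eta%:E.
Proof.
move=> cF cK [Xe [X [XeE XE XeX]]] eta0.
have mF : measurable (th @^-1` F) by exact: borel_map_closed.
have mK : measurable [set w | ~ K (th w)].
  exact: measurableC (borel_map_closed borel_th (compact_closed hTheta cK)).
pose A : set (set_type K) := [set u | F (set_val u)].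
(* If [F] misses [K], the supremum over [A] is a default value, but the event to bound is empty. *)
have [A0|/set0P A0] := eqVneq A set0.
  apply: nearW => e.
  have -> : [set w | (F `&` K) (the e w)] = set0.
    apply/seteqP; split=> // w [Fw /set_val_surj[u uE]].
    by have : A u; [rewrite /A/= uE|rewrite A0].
  by rewrite mu_ext0// !adde_ge0// lee_fin ltW.
have T0 : [set: set_type K] !=set0 by have [u _] := A0; exists u.
pose phi (g : linfty R K) := (sup_on A g - sup_on setT g)%R.
have cphi : continuous phi.
  move=> g.
  have cA := @continuous_sup_on R _ _ _ A0 g.
  have cT := @continuous_sup_on R _ _ _ T0 g.
  exact: (cvgB cA cT).
have eta20 : (0 < eta / 2)%R by rewrite divr_gt0.
have [delta delta0 near_phi] := weak_cvg_superlevel XeX cphi eta20.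
have near_r := mu_ext_near_le (c := 0%R) eta20 (r_op1 delta0).
(* If [th w] were in [K] but not in [F], uniqueness would put [M w] strictly below its maximum on
   [F] and [K]. The compact gap then gives a [q] above the supremum over [A] and below the value at
   [th w], forcing [phi] to be negative. *)
have phi_le : P [set w | (0 <= phi (X w))%R] <=
    P (th @^-1` F) + P [set w | ~ K (th w)].
  have [bX _] := XeX.
  have mphi : measurable [set w | (0 <= phi (X w))%R].
    apply: (borel_map_closed bX (F := phi @^-1` [set y | (0 <= y)%R])).
    by apply: preimage_closed; [move=> ? _; exact: cphi|exact: closed_ge].
  rewrite -(measurable_mu_extE P mphi) -(measurable_mu_extE P mF).
  rewrite -(measurable_mu_extE P mK).
  apply: le_trans (mu_extU2 _ _ _); apply: mu_ext_ae_le.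
  apply: filterS2 argmax_th XE => w [uM maxM] XM phi0 /=.
  apply: contrapT => /not_orP[nFw /contrapT Kw].
  have [u uE] := set_val_surj Kw.
  have := usc_compact_lt (m := (set_val (X w) : _ -> R) u) uM
    (compact_closedI cK cF).
  case=> [t [Kt Ft]|q qm Mq].
    by rewrite XM uE; apply: maxM => tE; apply: nFw; rewrite -tE.
  have : (sup_on A (X w) <= q)%R.
    apply: sup_on_le => // v Av; rewrite -lee_fin XM ltW//.
    by apply: Mq; split => //; exact: set_valP.
  move: phi0; rewrite /phi/= subr_ge0 => /le_trans /[apply] supq.
  have /le_trans/(_ supq) := @le_sup_on _ _ _ setT (X w) u I.
  by rewrite leNgt qm.
near=> e; have e0 : (0 < e)%R by near: e; exact: nbhs_pinfty_gt.
(* When the error is at most [delta], the value at [the e w] bounds the supremum over [K] up to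
   [delta], and it is itself at most the supremum over [A]. *)
apply: (@le_trans _ _ (mu_ext P ([set w | (- delta <= phi (Xe e w))%R] `|`
    [set w | (delta < `|r e w|)%R]))).
  apply: mu_ext_ae_le; apply: filterS2 (near_max e0) (XeE e e0) => w.
  move=> maxe XM [Fw Kw] /=.
  have [r_le|] := leP `|r e w|%R delta; last by right.
  left; have [u uE] := set_val_surj Kw.
  rewrite /phi lerBrDr addrC lerBlDr; apply: sup_on_le => // v _.
  have Au : A u by rewrite /A/= uE.
  apply: (@le_trans _ _ ((set_val (Xe e w) : _ -> R) u + r e w)%R); last first.
    by apply: lerD; [exact: le_sup_on|exact: le_trans (ler_norm _) r_le].
  rewrite -lerBlDr -lee_fin EFinB !XM uE; apply: le_trans maxe.
  by apply: leeD2r; apply: ereal_sup_ubound; exists (set_val v).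
apply: (le_trans (mu_extU2 _ _ _)).
apply: (@le_trans _ _ (P [set w | (0 <= phi (X w))%R] + (eta / 2)%:E +
    (0 + eta / 2)%:E)).
  by apply: leeD; near: e; [exact: near_phi|exact: near_r].
rewrite -addeA -EFinD add0r -splitr leeD2r//.
Unshelve. all: end_near. Qed.

Lemma argmax_cvg :
  (forall K, compact K -> weak_cvg_linfty P K Me M) ->
  (forall c : R, (0 < c)%R -> exists K : set Theta,
    [/\ compact K,
        limf_esup (fun e => mu_ext P [set w | ~ K (the e w)]) (pinfty_nbhs R)
          <= c%:E
      & P [set w | ~ K (th w)] <= c%:E]) ->
  weak_cvg P the th.
Proof.
move=> ucvg tight; apply: weak_cvg_closed => // F cF eta eta0.
(* Four quarters: one from [argmax_near_le], two for [the e] leaving [K] (the limsup bound and its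
   slack), one for [th] leaving [K]. *)
have eta40 : (0 < eta / 4)%R by rewrite divr_gt0.
have [K [cK limK PK]] := tight _ eta40.
have : \forall e \near +oo%R,
    mu_ext P [set w | ~ K (the e w)] <= (eta / 4 + eta / 4)%:E.
  exact: (limf_esup_near_le eta40 limK).
have := argmax_near_le cF cK (ucvg K cK) eta40.
apply: filterS2 => e FK nK.
apply: (@le_trans _ _ (mu_ext P ([set w | (F `&` K) (the e w)] `|`
    [set w | ~ K (the e w)]))).
  by apply: le_mu_ext => w Fw; have [Kw|nKw] := pselect (K (the e w));
    [left|right].
apply: (le_trans (mu_extU2 _ _ _)); apply: (le_trans (leeD FK nK)).
rewrite -!addeA leeD2l//; apply: (le_trans (leeD2r _ PK)).
rewrite -!EFinD lee_fin; lra.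
Qed.

End argmax.

Theorem theorem4p5 (R : realType) (Theta : metricType R)
  (n0 : nat) (n0_gt0 : (0 < n0)%N) (th0 : Theta)
  (* data spaces, indexed by the sample size, with p(x | theta, n = k) *)
  (dX : measure_display) (X : nat -> measurableType dX)
  (nu : forall k, {sigma_finite_measure set (X k) -> \bar R})
  (px : forall k, Theta -> X k -> R)
  (px_density : forall k th, (0 < k)%N -> is_density (nu k) (px k th))
  (* privatized summary, with p(s | x) *)
  (dS : measure_display) (S : measurableType dS)
  (muS : {sigma_finite_measure set S -> \bar R})
  (ps : forall k, X k -> S -> R)
  (ps_measurable : forall k, (0 < k)%N ->
    measurable_fun setT (fun z : X k * S => ps k z.1 z.2))
  (ps_density : forall k (x : X k), (0 < k)%N -> is_density muS (ps k x))
  (* privatized sample size, with p_e(ndp | n = k), and prior on the size *)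
  (dN : measure_display) (N : measurableType dN)
  (muN : {sigma_finite_measure set N -> \bar R})
  (pdp : R -> nat -> N -> R)
  (pdp_density : forall e k, (0 < e)%R -> (0 < k)%N ->
    is_density muN (pdp e k))
  (prior : nat -> R) (prior_ge0 : forall k, (0 <= prior k)%R)
  (* the sample: data x of size n0, s given x, and ndp given n = n0 *)
  (d : measure_display) (Omega : measurableType d) (P : probability Omega R)
  (x : Omega -> X n0) (s : Omega -> S) (ndp : R -> Omega -> N)
  (x_measurable : measurable_fun setT x)
  (s_measurable : measurable_fun setT s)
  (ndp_measurable : forall e, (0 < e)%R -> measurable_fun setT (ndp e))
  (sample_law : forall e, (0 < e)%R ->
    forall (A : set (X n0)) (B : set S) (C : set N),
    measurable A -> measurable B -> measurable C ->
    P (x @^-1` A `&` s @^-1` B `&` ndp e @^-1` C) =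
    \int[nu n0]_(y in A) ((px n0 th0 y)%:E
      * (\int[muS]_(t in B) (ps n0 y t)%:E)
      * (\int[muN]_(m in C) (pdp e n0 m)%:E)))
  (posterior_proper : forall e, (0 < e)%R ->
    {ae P, forall w, proper_posterior pdp prior e (ndp e w)})
  (L : Theta -> S -> \bar R) (L_def : L = marginal nu px ps n0)
  (Leps : R -> Theta -> S -> N -> \bar R)
  (Leps_def : Leps = unbounded_lik nu px ps pdp prior)
  (* near maximizers of the unbounded-DP likelihood *)
  (theta_hat_eps : R -> Omega -> Theta)
  (theta_hat_eps_near_max : exists2 r : R -> Omega -> R, little_op1 P r &
    forall e, (0 < e)%R -> {ae P, forall w,
      ereal_sup [set Leps e th (s w) (ndp e w) | th in [set: Theta]]
        - (r e w)%:E
      <= Leps e (theta_hat_eps e w) (s w) (ndp e w)})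
  (* (i) *)
  (theta_hat : S -> Theta) (theta_hat_borel : borel_map (theta_hat \o s))
  (unique_mle : {ae P, forall w,
    upper_semicontinuous (L ^~ (s w)) /\
    unique_maximum (L ^~ (s w)) (theta_hat (s w))})
  (* (ii) *)
  (uniform_cvg : forall K : set Theta, compact K ->
    weak_cvg_linfty P K
      (fun e w th => Leps e th (s w) (ndp e w)) (fun w th => L th (s w)))
  (* (iii) *)
  (tightness : forall c : R, (0 < c)%R -> exists K : set Theta,
    [/\ compact K,
        limf_esup (fun e => mu_ext P [set w | ~ K (theta_hat_eps e w)])
          (pinfty_nbhs R) <= c%:E
      & P [set w | ~ K (theta_hat (s w))] <= c%:E]) :
  weak_cvg P theta_hat_eps (theta_hat \o s).
Proof.
case: theta_hat_eps_near_max => r r_op1 near_max.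
(* The processes are the two likelihoods along a sample. A metric space is Hausdorff, so its compact
   sets are closed and their preimages under the MLE measurable. *)
exact: (argmax_cvg (@metric_hausdorff _ Theta) r_op1 near_max theta_hat_borel
  unique_mle uniform_cvg tightness).
Qed.
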